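(* For every nonzero ideal $\mathfrak n$ of $A$ generated by a monic polynomial $n$, \[T_{\mathfrak n}E(z,s)=|\mathfrak n|^s\,\sigma_{1-2s}(\mathfrak n)\,E(z,s).\]
   Context: $q$ odd prime power, $A=\mathbb{F}_q[T]$, $k_\infty=\mathbb{F}_q((T^{-1}))$, $|T|=q$, $\Omega=\mathbb{C}_\infty\smallsetminus k_\infty$, $\Gamma=\mathrm{PGL}_2(A)$, $\Gamma_\infty$ its upper-triangular subgroup. $|z|_i=\min_{w\in k_\infty}|z-w|$ and $E(z,s)=\sum_{\gamma\in\Gamma_\infty\backslash\Gamma}|\gamma z|_i^s$. The Hecke operator is $T_{\mathfrak n}F(z)=\sum_{a\text{ monic},\,ad=n,\,\deg b<\deg d}F\big(\frac{az+b}{d}\big)$ for $F$ on $\Gamma\backslash\Omega$; $|\mathfrak n|=q^{\deg n}$; and $\sigma_s(\mathfrak n)=\sigma_s(n)=\sum_{m\text{ monic},\,m\mid n}|m|^s$. *)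

(* Defs.v *)
From mathcomp Require Import all_boot all_order all_algebra.
From mathcomp Require Import all_classical all_reals all_analysis.
From mathcomp Require Export complex.
Set Implicit Arguments. Unset Strict Implicit. Unset Printing Implicit Defensive.
Import Order.TTheory GRing.Theory Num.Theory.
Local Open Scope ring_scope.
Local Open Scope classical_set_scope.

(* Setting.  F = F_q (finite field, q = #|F|), A = {poly F} = F_q[T].        *)
(* C_infty is modelled by an abstract algebraically closed field K with an    *)
(* absolute value abs : K -> R and a ring embedding emb : A -> K, subject to *)
(* [is_Cinf], which characterises (K, abs) up to isometric isomorphism as the*)
(* completion of an algebraic closure of k_infty = F_q((1/T)):               *)
(*  - abs is a non-archimedean absolute value on K, with |a| = q^deg a on A; *)
(*  - K is complete;                                                          *)
(*  - k_infty is the closure in K of Frac(emb A) = F_q(T);                    *)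
(*  - the elements of K algebraic over k_infty are dense in K.                *)

Notation i0 := (@Ordinal 2 0 isT).
Notation i1 := (@Ordinal 2 1 isT).

Section Cinf.
Variables (F : finFieldType) (R : realType) (K : closedFieldType)
  (abs : K -> R) (emb : {rmorphism {poly F} -> K}).

Definition qF : R := (#|F|)%:R.

(* |a| = q^(deg a) for a in A, |0| = 0 ; this is |n| = #(A/nA) for ideals *)
Definition absA (a : {poly F}) : R := if a == 0 then 0 else qF ^+ (size a).-1.

Definition kinf : set K :=
  [set x | forall e : R, 0 < e ->
     exists a b : {poly F}, b != 0 /\ abs (x - emb a / emb b) < e].

Definition algebraic_over (S : set K) (x : K) : Prop :=
  exists p : {poly K}, p != 0 /\ (forall i, S p`_i) /\ root p x.

Definition is_Cinf : Prop :=
  (forall x, abs x = 0 <-> x = 0) /\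
  (forall x, 0 <= abs x) /\
  (forall x y, abs (x * y) = abs x * abs y) /\
  (forall x y, abs (x + y) <= Num.max (abs x) (abs y)) /\
  (forall a, abs (emb a) = absA a) /\
  (forall u : nat -> K,
     (forall e : R, 0 < e -> exists N, forall m n, (N <= m)%N -> (N <= n)%N ->
         abs (u m - u n) < e) ->
     exists l, forall e : R, 0 < e -> exists N, forall n, (N <= n)%N ->
         abs (u n - l) < e) /\
  (forall x (e : R), 0 < e -> exists y, algebraic_over kinf y /\ abs (x - y) < e).

Definition Omega (z : K) : Prop := ~ kinf z.

Definition imag_abs (z : K) : R := inf [set abs (z - w) | w in kinf].

(* Gamma = PGL_2(A) is handled via GL_2(A) = matrices with unit determinant; *)
(* scalars (F^* ) lie in the upper triangular group, so                      *)
(* Gamma_infty \ Gamma = { B(A) g : g in GL_2(A) },  B(A) upper triangular.  *)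
Definition GL2A : set 'M[{poly F}]_2 := [set g | \det g \is a GRing.unit].
Definition Binf : set 'M[{poly F}]_2 := [set u | GL2A u /\ u i1 i0 = 0].
Definition rcoset (g : 'M[{poly F}]_2) : set 'M[{poly F}]_2 :=
  [set u *m g | u in Binf].
Definition cosets : set (set 'M[{poly F}]_2) := [set rcoset g | g in GL2A].

Definition mob (g : 'M[{poly F}]_2) (z : K) : K :=
  (emb (g i0 i0) * z + emb (g i0 i1)) / (emb (g i1 i0) * z + emb (g i1 i1)).

Definition cpow (x : R) (s : R[i]) : R[i] :=
  let r : R := expR (complex.Re s * ln x) in
  let th : R := complex.Im s * ln x in
  (r%:C)%C * ((cos th) +i* (sin th))%C.

(* sum of an (absolutely summable) complex family over a set *)
Definition csum (T : choiceType) (S : set T) (f : T -> R[i]) : R[i] :=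
  let ps g := fine (esum S (fun t => (Num.max (g t) 0)%:E)) in
  ((ps (fun t => complex.Re (f t)) - ps (fun t => - complex.Re (f t))) +i*
   (ps (fun t => complex.Im (f t)) - ps (fun t => - complex.Im (f t))))%C.

(* E(z,s) = sum_{gamma in Gamma_infty \ Gamma} |gamma z|_i^s ; the summand   *)
(* is evaluated at a representative of the coset (it is independent of it). *)
Definition Eis (z : K) (s : R[i]) : R[i] :=
  csum cosets (fun C => cpow (imag_abs (mob (xget 0 C) z)) s).

Definition polyv (m : nat) (v : {ffun 'I_m -> F}) : {poly F} := Poly (codom v).

(* Hecke operator: T_n f(z) = sum_{a monic, ad = n, deg b < deg d} f((az+b)/d).*)
(* Monic divisors a of n have size <= size n, enumerated by coefficient      *)
(* vectors of length size n; the b with deg b < deg d = (size d).-1 are      *)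
(* enumerated by coefficient vectors of length (size d).-1.                  *)
Definition hecke (f : K -> R[i]) (n : {poly F}) (z : K) : R[i] :=
  \sum_(t : {ffun 'I_(size n) -> F} | (polyv t \is monic) && (polyv t %| n))
    \sum_(v : {ffun 'I_((size (n %/ polyv t)).-1) -> F})
       f ((emb (polyv t) * z + emb (polyv v)) / emb (n %/ polyv t)).

Definition sigmaA (s : R[i]) (n : {poly F}) : R[i] :=
  \sum_(t : {ffun 'I_(size n) -> F} | (polyv t \is monic) && (polyv t %| n))
    cpow (absA (polyv t)) s.

End Cinf.

(* Main.v *)
Require Import Defs.
From mathcomp Require Import all_boot all_order all_algebra.
From mathcomp Require Import all_classical all_reals all_analysis.
From mathcomp Require Import complex.
From mathcomp Require Import ring.
Set Implicit Arguments. Unset Strict Implicit. Unset Printing Implicit Defensive.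
Import Order.TTheory GRing.Theory Num.Theory.
Local Open Scope ring_scope.
Local Open Scope classical_set_scope.

(* Let D_n be the set of cosets B g, for the matrices g over A whose determinant
   is n up to a unit, B being the upper triangular subgroup of GL_2(A), and let M run
   over the Hermite forms (a b; 0 d) with a monic, ad = n and deg b < deg d.
   Both (M, B g) |-> B g M and (M, B g) |-> B M g, with g the chosen
   representative of its coset, are bijections onto D_n. Sum |gz|_i^s over D_n.
   Through the first bijection this is T_n E(z, s). Since
   |gz|_i = |det g| |z|_i / |cz + d|^2, through the second it is
   sum_d |d| (|n| / |d|^2)^s E(z, s), the factor |d| counting the residues b.
   The rearrangements are licit because |cz + d| is bounded below by a multiple of
   max(|c|, |d|), which makes the series converge absolutely for Re s > 1. *)

(** * Two by two matrices *)

Lemma det_adj (A : idomainType) (n : nat) (g : 'M[A]_n.+1) :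
  \det g != 0 -> \det (\adj g) = \det g ^+ n.
Proof.
by move=> dg; apply: (mulfI dg); rewrite -det_mulmx mul_mx_adj det_scalar exprS.
Qed.

Section TwoByTwo.
Variable A : comPzRingType.
Implicit Types (a b c d : A) (g h : 'M[A]_2).

Definition mx2 a b c d : 'M[A]_2 :=
  \matrix_(i < 2, j < 2)
    (if i == i0 then if j == i0 then a else b else if j == i0 then c else d).

Lemma mx2_00 a b c d : mx2 a b c d i0 i0 = a. Proof. by rewrite mxE. Qed.
Lemma mx2_01 a b c d : mx2 a b c d i0 i1 = b. Proof. by rewrite mxE. Qed.
Lemma mx2_10 a b c d : mx2 a b c d i1 i0 = c. Proof. by rewrite mxE. Qed.
Lemma mx2_11 a b c d : mx2 a b c d i1 i1 = d. Proof. by rewrite mxE. Qed.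
Definition mx2E := (mx2_00, mx2_01, mx2_10, mx2_11).

Lemma ord2P (i : 'I_2) : i = i0 \/ i = i1.
Proof. by case: i => [[|[|//]] lt_i2]; [left|right]; apply/val_inj. Qed.

Lemma mx2_eta g : g = mx2 (g i0 i0) (g i0 i1) (g i1 i0) (g i1 i1).
Proof.
by apply/matrixP=> i j; case: (ord2P i) => ->; case: (ord2P j) => ->; rewrite mx2E.
Qed.

Lemma mx2_inj a b c d a' b' c' d' : mx2 a b c d = mx2 a' b' c' d' ->
  [/\ a = a', b = b', c = c' & d = d'].
Proof.
move=> /matrixP eq_mx.
by move: (eq_mx i0 i0) (eq_mx i0 i1) (eq_mx i1 i0) (eq_mx i1 i1); rewrite !mx2E.
Qed.

Lemma mulmx22E g h i j : (g *m h) i j = g i i0 * h i0 j + g i i1 * h i1 j.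
Proof.
rewrite mxE big_ord_recl big_ord1.
by congr (g i _ * h _ j + g i _ * h _ j); apply/val_inj.
Qed.

Lemma mul_mx2 a b c d a' b' c' d' :
  mx2 a b c d *m mx2 a' b' c' d' =
  mx2 (a * a' + b * c') (a * b' + b * d') (c * a' + d * c') (c * b' + d * d').
Proof. by rewrite [LHS]mx2_eta !mulmx22E !mx2E. Qed.

Lemma scalar_mx2 a : a%:M = mx2 a 0 0 a.
Proof. by rewrite [LHS]mx2_eta !mxE. Qed.

Lemma det_mx22E g : \det g = g i0 i0 * g i1 i1 - g i0 i1 * g i1 i0.
Proof.
rewrite (expand_det_row _ i0) big_ord_recl big_ord1 /cofactor !det_mx11 !mxE /=.
rewrite expr0 mul1r expr1 mulN1r mulrN.
by congr (g _ _ * g _ _ - g _ _ * g _ _); apply/val_inj.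
Qed.

Lemma det_mx2 a b c d : \det (mx2 a b c d) = a * d - b * c.
Proof. by rewrite det_mx22E !mx2E. Qed.

Lemma row1_neq0 g : \det g != 0 -> (g i1 i0 != 0) || (g i1 i1 != 0).
Proof.
apply: contraNT; rewrite negb_or !negbK det_mx22E => /andP[/eqP-> /eqP->].
by rewrite !mulr0 subrr.
Qed.

End TwoByTwo.

(** * Polynomials over a field *)

Section Polynomials.
Variable F : fieldType.
Implicit Types p q : {poly F}.

Lemma unit_poly_eqp1 p : (p \is a GRing.unit) = (p %= 1).
Proof.
rewrite -size_poly_eq1 poly_unitE andb_idr// => /size_poly1P[c c0 ->].
by rewrite coefC unitfE.
Qed.

Lemma eqp_unit_mull p q : p \is a GRing.unit -> p * q %= q.
Proof. by rewrite unit_poly_eqp1 => /(eqp_mulr q); rewrite mul1r. Qed.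

Lemma coprimep_proportional p q :
  exists p' q' : {poly F}, coprimep p' q' /\ q' * p = p' * q.
Proof.
have [->|p0] := eqVneq p 0; first by exists 0, 1; rewrite coprimep1 mul0r mulr0.
exists (p %/ gcdp p q), (q %/ gcdp p q); split; first by rewrite coprimep_div_gcd ?p0.
by rewrite !divp_mulAC ?dvdp_gcdl ?dvdp_gcdr// mulrC.
Qed.

Lemma divp_monic_divisor p q : p \is monic -> q \is monic -> q %| p ->
  [/\ p %/ q \is monic, p %/ q %| p & p %/ (p %/ q) = q].
Proof.
move=> pm qm qp; have pE : p = q * (p %/ q) by rewrite mulrC divpK.
have dm : p %/ q \is monic by move: pm; rewrite {1}pE monicMl.
split => //; first by rewrite {2}pE dvdp_mull.
by rewrite {1}pE mulpK// monic_neq0.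
Qed.

End Polynomials.

Section CoefficientVectors.
Variable F : finFieldType.
Implicit Types n p : {poly F}.

Lemma coef_polyv m (v : {ffun 'I_m -> F}) (i : 'I_m) : (polyv v)`_i = v i.
Proof. by rewrite coef_Poly codom_ffun nth_fgraph_ord. Qed.

Lemma size_polyv m (v : {ffun 'I_m -> F}) : (size (polyv v) <= m)%N.
Proof. by rewrite (leq_trans (size_Poly _))// size_codom card_ord. Qed.

Lemma polyv_inj m : injective (@polyv F m).
Proof. by move=> v w eq_vw; apply/ffunP => i; rewrite -!coef_polyv eq_vw. Qed.

Definition coefv m p : {ffun 'I_m -> F} := [ffun i : 'I_m => p`_i].

Lemma coefvK m p : (size p <= m)%N -> polyv (coefv m p) = p.
Proof.
move=> sp; apply/polyP => i; case: (ltnP i m) => im.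
  by rewrite (coef_polyv _ (Ordinal im)) ffunE.
by rewrite !nth_default// ?(leq_trans sp)// (leq_trans (size_polyv _)).
Qed.

Lemma size_polyv_lt m (v : {ffun 'I_m.-1 -> F}) : (0 < m)%N -> (size (polyv v) < m)%N.
Proof. by move=> m0; rewrite (leq_ltn_trans (size_polyv v))// prednK. Qed.

Definition monic_divisor n (t : {ffun 'I_(size n) -> F}) :=
  (polyv t \is monic) && (polyv t %| n).

Lemma divp_divisor_neq0 n (t : {ffun 'I_(size n) -> F}) :
  n != 0 -> monic_divisor t -> n %/ polyv t != 0.
Proof.
by move=> n0 /andP[_ dv]; apply: contraNneq n0 => d0; rewrite -(divpK dv) d0 mul0r.
Qed.

Lemma sum_divisor_compl n (V : nmodType) (G : {poly F} -> V) : n \is monic ->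
  \sum_(t | @monic_divisor n t) G (n %/ polyv t) =
  \sum_(t | @monic_divisor n t) G (polyv t).
Proof.
move=> nm; have n0 : n != 0 by rewrite monic_neq0.
have compl_divisor (t : {ffun 'I_(size n) -> F}) : monic_divisor t ->
    [/\ n %/ polyv t \is monic, n %/ polyv t %| n & n %/ (n %/ polyv t) = polyv t].
  by move=> /andP[tm tn]; apply: divp_monic_divisor.
pose compl (t : {ffun 'I_(size n) -> F}) := coefv (size n) (n %/ polyv t).
have complE t : monic_divisor t -> polyv (compl t) = n %/ polyv t.
  by move=> /compl_divisor[_ dn _]; rewrite coefvK// dvdp_leq.
have divisor_compl t : monic_divisor t -> monic_divisor (compl t).
  by move=> dt; rewrite /monic_divisor complE//; have [-> ->] := compl_divisor _ dt.
have complK t : monic_divisor t -> compl (compl t) = t.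
  move=> dt; apply: polyv_inj; rewrite complE ?divisor_compl// complE//.
  by have [_ _] := compl_divisor _ dt.
rewrite [RHS](reindex_onto compl compl) => [|t]; last exact: complK.
apply: eq_big => [t|t dt]; last by rewrite complE.
by apply/idP/andP => [dt|[/divisor_compl + /eqP e]]; rewrite ?e// divisor_compl// complK.
Qed.

End CoefficientVectors.

(** * Cosets of the upper triangular subgroup *)

Local Notation coset_repr := (xget 0).

Section Cosets.
Variable F : finFieldType.
Implicit Types (g h u : 'M[{poly F}]_2) (C : set 'M[{poly F}]_2).

Lemma GL2A_unitmx g : GL2A g <-> g \in unitmx.
Proof. by rewrite unitmxE. Qed.

Lemma GL2A_mul g h : GL2A g -> GL2A h -> GL2A (g *m h).
Proof.
by move=> /GL2A_unitmx ug /GL2A_unitmx uh; apply/GL2A_unitmx; rewrite unitmx_mul ug.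
Qed.

Lemma GL2A_inv g : GL2A g -> GL2A (invmx g).
Proof. by move=> /GL2A_unitmx ug; apply/GL2A_unitmx; rewrite unitmx_inv. Qed.

Lemma GL2A_det_neq0 g : GL2A g -> \det g != 0.
Proof. by move=> ug; apply: contraTneq ug => ->; rewrite unitr0. Qed.

Lemma Binf1 : Binf (1%:M : 'M[{poly F}]_2).
Proof. by split; [apply/GL2A_unitmx/unitmx1|rewrite scalar_mx2 mx2E]. Qed.

Lemma Binf_mul g h : Binf g -> Binf h -> Binf (g *m h).
Proof.
move=> [ug g0] [uh h0]; split; first exact: GL2A_mul.
by rewrite mulmx22E g0 h0 mul0r mulr0 addr0.
Qed.

Lemma Binf_inv g : Binf g -> Binf (invmx g).
Proof.
move=> [Gg g10]; split; first exact: GL2A_inv.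
have /matrixP/(_ i1 i0) := mulmxV ((GL2A_unitmx g).1 Gg).
rewrite mulmx22E g10 mul0r add0r scalar_mx2 mx2E => /eqP.
rewrite mulf_eq0 => /orP[g11|/eqP//].
by have := row1_neq0 (GL2A_det_neq0 Gg); rewrite g10 eqxx g11.
Qed.

Lemma mem_rcoset g : rcoset g g.
Proof. by exists 1%:M; [exact: Binf1|rewrite mul1mx]. Qed.

Lemma eq_rcosetP g h : rcoset g = rcoset h <-> exists2 u, Binf u & g = u *m h.
Proof.
split=> [eq_gh|[u Bu ->]].
  by have := mem_rcoset g; rewrite eq_gh => -[u Bu <-]; exists u.
apply/seteqP; split=> _ [v Bv <-].
  by exists (v *m u); [exact: Binf_mul|rewrite mulmxA].
exists (v *m invmx u); first by apply: Binf_mul => //; apply: Binf_inv.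
by have [/GL2A_unitmx uu _] := Bu; rewrite mulmxA mulmxKV.
Qed.

Lemma eq_rcoset_row1 g h : GL2A g -> GL2A h ->
  g i1 i0 = h i1 i0 -> g i1 i1 = h i1 i1 -> rcoset g = rcoset h.
Proof.
move=> Gg Gh e0 e1; have uh : h \in unitmx by apply/GL2A_unitmx.
apply/eq_rcosetP; exists (g *m invmx h); last by rewrite mulmxKV.
split; first by apply: GL2A_mul => //; apply: GL2A_inv.
by rewrite mulmx22E e0 e1 -mulmx22E mulmxV// scalar_mx2 mx2E.
Qed.

Lemma coset_repr_rcoset g : exists2 u, Binf u & coset_repr (rcoset g) = u *m g.
Proof.
have /= [u Bu <-] : rcoset g (xget 0 (rcoset g)).
  by apply: xgetPex; exists g; exact: mem_rcoset.
by exists u.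
Qed.

Lemma GL2A_coset_repr C : cosets C -> GL2A (coset_repr C).
Proof.
by move=> [g Gg <-]; have [u [Gu _] ->] := coset_repr_rcoset g; apply: GL2A_mul.
Qed.

Lemma coset_reprK C : cosets C -> rcoset (coset_repr C) = C.
Proof.
move=> [g Gg <-]; have [u Bu ->] := coset_repr_rcoset g.
by apply/eq_rcosetP; exists u.
Qed.

Lemma det_coset_repr_neq0 C : cosets C -> \det (coset_repr C) != 0.
Proof. by move=> /GL2A_coset_repr/GL2A_det_neq0. Qed.

Definition det_cosets (n : {poly F}) : set (set 'M[{poly F}]_2) :=
  [set rcoset g | g in [set g | \det g %= n]].

Lemma exists_lmul_triangular g : exists2 h, GL2A h & (h *m g) i1 i0 = 0.
Proof.
have [p [q [/Bezout_eq1_coprimepP[[u v] /= uv] pq]]] :=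
  coprimep_proportional (g i0 i0) (g i1 i0).
exists (mx2 u v (- q) p); last by rewrite mulmx22E !mx2E mulNr pq addrC subrr.
by rewrite /GL2A /= det_mx2 mulrN opprK uv unitr1.
Qed.

Lemma exists_rmul_triangular g : exists2 h, GL2A h & (g *m h) i1 i0 = 0.
Proof.
have [p [q [/Bezout_eq1_coprimepP[[u v] /= uv] pq]]] :=
  coprimep_proportional (g i1 i0) (g i1 i1).
exists (mx2 q u (- p) v).
  by rewrite /GL2A /= det_mx2 mulrN opprK mulrC addrC uv unitr1.
by rewrite mulmx22E !mx2E mulrN mulrC pq mulrC subrr.
Qed.

End Cosets.

(** * Hermite normal forms *)

Section HermiteForm.
Variable F : finFieldType.
Implicit Types (g h u : 'M[{poly F}]_2) (n : {poly F}).

Definition hermite_index n :=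
  {t : {ffun 'I_(size n) -> F} & {ffun 'I_(size (n %/ polyv t)).-1 -> F}}.

Definition hermite_valid n (j : hermite_index n) := monic_divisor (tag j).

Definition hermite_mx n (j : hermite_index n) : 'M[{poly F}]_2 :=
  mx2 (polyv (tag j)) (polyv (tagged j)) 0 (n %/ polyv (tag j)).

Lemma det_hermite_mx n (j : hermite_index n) : hermite_valid j -> \det (hermite_mx j) = n.
Proof. by move=> /andP[_ dv]; rewrite det_mx2 mulr0 subr0 mulrC divpK. Qed.

Lemma exists_hermite_index (a b d : {poly F}) : a \is monic -> d != 0 ->
  (size b < size d)%N ->
  exists2 j : hermite_index (a * d), hermite_valid j & hermite_mx j = mx2 a b 0 d.
Proof.
move=> am d0 bd; have a0 := monic_neq0 am.
pose t := coefv (size (a * d)) a.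
have tK : polyv t = a by rewrite coefvK// dvdp_leq ?mulf_neq0// dvdp_mulr.
exists (existT _ t (coefv _ b)).
  by rewrite /hermite_valid /monic_divisor /= tK am dvdp_mulr.
by rewrite /hermite_mx /= tK mulKp// coefvK// -ltnS prednK// size_poly_gt0.
Qed.

Lemma hermite_exists n g : n \is monic -> g i1 i0 = 0 -> \det g %= n ->
  exists u (j : hermite_index n), [/\ Binf u, hermite_valid j & g = u *m hermite_mx j].
Proof.
move=> nm; rewrite (mx2_eta g) mx2E => ->.
move: (g i0 i0) (g i0 i1) (g i1 i1) => p q r; rewrite det_mx2 mulr0 subr0 => prn.
have pr0 : p * r != 0 by rewrite -eqp0 (eqp_ltrans prn) eqp0 monic_neq0.
have /andP[p0 r0] : (p != 0) && (r != 0) by rewrite -negb_or -mulf_eq0.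
pose a := (lead_coef p)^-1 *: p; pose d := (lead_coef r)^-1 *: r.
have [cp0 cr0] : lead_coef p != 0 /\ lead_coef r != 0 by rewrite !lead_coef_eq0.
have [am dm] : a \is monic /\ d \is monic by rewrite !monicE !lead_coefZ !mulVf.
have [pE rE] : p = lead_coef p *: a /\ r = lead_coef r *: d.
  by rewrite !scalerA !mulfV// !scale1r.
have nE : n = a * d.
  apply/eqP; rewrite -eqp_monic ?rpredM// eqp_sym (eqp_trans _ prn)//.
  by rewrite -scalerAl -scalerAr scalerA eqp_scale// mulf_neq0 ?invr_eq0.
pose b := (lead_coef p)^-1 *: q.
have [|j vj jE] := @exists_hermite_index a (b %% d) d am (monic_neq0 dm).
  by rewrite ltn_modp monic_neq0.
rewrite nE; exists (mx2 (lead_coef p)%:P (lead_coef p *: (b %/ d)) 0 (lead_coef r)%:P), j.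
split=> //.
  split; last by rewrite mx2E.
  by rewrite /GL2A /= det_mx2 mulr0 subr0 -polyCM rmorph_unit// unitfE mulf_neq0.
rewrite jE mul_mx2 !mulr0 !mul0r !addr0 !add0r !mul_polyC -pE -rE; congr mx2.
by rewrite -scalerAl -scalerDr addrC -divp_eq scalerA mulfV// scale1r.
Qed.

Lemma hermite_unique n (j k : hermite_index n) u : n != 0 ->
  hermite_valid j -> hermite_valid k -> GL2A u ->
  u *m hermite_mx j = hermite_mx k -> u = 1%:M /\ j = k.
Proof.
move=> n0; case: j k => [t v] [t' v'] vj vk.
have d0 := divp_divisor_neq0 n0 vj; move: vj vk d0 => /andP[/= tm _] /andP[/= t'm _] d0.
have t0 : polyv t != 0 := monic_neq0 tm.
rewrite /hermite_mx /= (mx2_eta u).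
move: (u i0 i0) (u i0 i1) (u i1 i0) (u i1 i1) => p q r s.
rewrite /GL2A /= det_mx2 mul_mx2 => + /mx2_inj[].
rewrite !mulr0 !addr0 => + ptE qdE /eqP.
rewrite mulf_eq0 (negPf t0) orbF => + /eqP r0 sdE.
rewrite r0 mulr0 subr0 unitrM => /andP[+ _].
rewrite poly_unitE => /andP[/size_poly1P[c _ pE] _].
have c1 : c = 1.
  move: ptE => /(congr1 lead_coef).
  by rewrite pE mul_polyC lead_coefZ (monicP tm) (monicP t'm) mulr1.
move: ptE qdE; rewrite pE c1 !mul1r => /polyv_inj eq_t; subst t' => qdE.
have small_lt (w : {ffun 'I_(size (n %/ polyv t)).-1 -> F}) :
    (size (polyv w) < size (n %/ polyv t)%R)%N.
  by rewrite size_polyv_lt// size_poly_gt0.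
have q0 : q = 0.
  by rewrite -(divp_addl_mul_small q (small_lt v)) addrC qdE divp_small ?small_lt.
have s1 : s = 1 by apply: (mulIf d0); rewrite mul1r -[RHS]sdE r0 mul0r add0r.
move: qdE; rewrite q0 mul0r addr0 => /polyv_inj ->.
by rewrite s1 polyC1 -scalar_mx2.
Qed.

Lemma GL2A_mul_hermite_inj n (j k : hermite_index n) g h : n != 0 ->
  hermite_valid j -> hermite_valid k -> GL2A g -> GL2A h ->
  g *m hermite_mx j = h *m hermite_mx k -> g = h /\ j = k.
Proof.
move=> n0 vj vk Gg Gh eq_gh; have uh : h \in unitmx by apply/GL2A_unitmx.
have [| |quot1 ->] := @hermite_unique n j k (invmx h *m g) n0 vj vk.
- by apply: GL2A_mul => //; apply: GL2A_inv.
- by rewrite -mulmxA eq_gh mulKmx.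
by split=> //; rewrite -(mulKVmx uh g) quot1 mulmx1.
Qed.

Lemma GL2A_mul_hermite_exists n g : n \is monic -> \det g %= n ->
  exists h (j : hermite_index n), [/\ GL2A h, hermite_valid j & g = h *m hermite_mx j].
Proof.
move=> nm dg; have [h Gh hg10] := exists_lmul_triangular g.
have uh : h \in unitmx by apply/GL2A_unitmx.
have [|u [j [[Gu _] vj hgE]]] := hermite_exists nm hg10.
  by rewrite det_mulmx (eqp_trans _ dg)// eqp_unit_mull.
exists (invmx h *m u), j; split=> //; last by rewrite -mulmxA -hgE mulKmx.
by apply: GL2A_mul => //; apply: GL2A_inv.
Qed.

Lemma set_bij_repr_mul_hermite n : n \is monic ->
  set_bij ([set j : hermite_index n | hermite_valid j] `*` @cosets F) (det_cosets n)
    (fun k => rcoset (coset_repr k.2 *m hermite_mx k.1)).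
Proof.
move=> nm; have n0 := monic_neq0 nm; split.
- move=> [j C] [/= vj cC]; exists (coset_repr C *m hermite_mx j) => //=.
  by rewrite det_mulmx det_hermite_mx// eqp_unit_mull//; apply: GL2A_coset_repr.
- move=> [j C] [k D] /set_mem[/= vj cC] /set_mem[/= vk cD] /eq_rcosetP[u Bu].
  rewrite mulmxA => /(GL2A_mul_hermite_inj n0 vj vk (GL2A_coset_repr cC))[|reprE ->].
    by apply: GL2A_mul (GL2A_coset_repr cD); case: Bu.
  congr pair; rewrite -(coset_reprK cC) -(coset_reprK cD).
  by apply/eq_rcosetP; exists u.
- move=> _ [g /= dg <-]; have [h [j [Gh vj ->]]] := GL2A_mul_hermite_exists nm dg.
  exists (j, rcoset h); first by split=> //; exists h.
  have [u Bu /= ->] := coset_repr_rcoset h.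
  by apply/eq_rcosetP; exists u => //; rewrite mulmxA.
Qed.

Lemma hermite_mul_GL2A_rcoset_inj n (j k : hermite_index n) u g h : n != 0 ->
  hermite_valid j -> Binf u -> GL2A g -> GL2A h ->
  hermite_mx j *m g = u *m hermite_mx k *m h -> rcoset g = rcoset h.
Proof.
move=> n0 vj Bu Gg Gh eq_gh; have uh : h \in unitmx by apply/GL2A_unitmx.
apply/eq_rcosetP; exists (g *m invmx h); last by rewrite mulmxKV.
split; first by apply: GL2A_mul => //; apply: GL2A_inv.
have /matrixP/(_ i1 i0) : hermite_mx j *m (g *m invmx h) = u *m hermite_mx k.
  by rewrite mulmxA eq_gh mulmxK.
rewrite !(mulmx22E _ _ i1) !mx2E Bu.2 !mulr0 !mul0r !addr0 !add0r => /eqP.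
by rewrite mulf_eq0 (negPf (divp_divisor_neq0 n0 vj)) => /eqP.
Qed.

Lemma exists_repr_triangular g :
  exists2 C, cosets C & (g *m invmx (coset_repr C)) i1 i0 = 0.
Proof.
have [h Gh gh10] := exists_rmul_triangular g; have uh : h \in unitmx by apply/GL2A_unitmx.
have cC : cosets (rcoset (invmx h)) by exists (invmx h) => //; apply: GL2A_inv.
exists (rcoset (invmx h)) => //; have [u Bu reprE] := coset_repr_rcoset (invmx h).
have uu : u \in unitmx by case: Bu => /GL2A_unitmx.
have ur : coset_repr (rcoset (invmx h)) \in unitmx by apply/GL2A_unitmx/GL2A_coset_repr.
have -> : g *m invmx (coset_repr (rcoset (invmx h))) = g *m h *m invmx u.
  by apply: (canLR (mulmxK ur)); rewrite reprE mulmxA mulmxKV// mulmxK.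
by rewrite mulmx22E gh10 (Binf_inv Bu).2 mul0r mulr0 addr0.
Qed.

Lemma set_bij_hermite_mul_repr n : n \is monic ->
  set_bij ([set j : hermite_index n | hermite_valid j] `*` @cosets F) (det_cosets n)
    (fun k => rcoset (hermite_mx k.1 *m coset_repr k.2)).
Proof.
move=> nm; have n0 := monic_neq0 nm; split.
- move=> [j C] [/= vj cC]; exists (hermite_mx j *m coset_repr C) => //=.
  by rewrite det_mulmx det_hermite_mx// mulrC eqp_unit_mull//; apply: GL2A_coset_repr.
- move=> [j C] [k D] /set_mem[/= vj cC] /set_mem[/= vk cD] /eq_rcosetP[u Bu].
  have [GC GD] := (GL2A_coset_repr cC, GL2A_coset_repr cD); rewrite mulmxA => eq_jk.
  have := hermite_mul_GL2A_rcoset_inj n0 vj Bu GC GD eq_jk.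
  rewrite (coset_reprK cC) (coset_reprK cD) => eq_CD; subst D; congr pair; apply/esym.
  apply: (proj2 (hermite_unique (u := u) n0 vk vj _ _)); first by case: Bu.
  by apply/esym/(can_inj (mulmxK ((GL2A_unitmx _).1 GC))).
- move=> _ [g /= dg <-]; have [C cC gr10] := exists_repr_triangular g.
  have GC := GL2A_coset_repr cC.
  have [|u [j [Bu vj grE]]] := hermite_exists nm gr10.
    rewrite det_mulmx mulrC (eqp_trans _ dg)// eqp_unit_mull//; exact: GL2A_inv.
  exists (j, C) => //=; apply/esym/eq_rcosetP; exists u => //.
  by rewrite mulmxA -grE mulmxKV//; apply/GL2A_unitmx.
Qed.

End HermiteForm.

(** * Unordered sums of real and complex families *)

Section ExtendedSums.
Variable R : realType.
Local Open Scope ereal_scope.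

Lemma le_esum_set (T : choiceType) (S S' : set T) (a : T -> \bar R) :
  S `<=` S' -> \esum_(t in S) a t <= \esum_(t in S') a t.
Proof.
move=> SS'; apply: ge_ereal_sup => _ [X [finX XS] <-].
by apply: ereal_sup_ubound; exists X => //; split => //; apply: subset_trans SS'.
Qed.

Lemma ge0_esumZl (T : choiceType) (S : set T) (a : T -> \bar R) (c : R) :
  (0 <= c)%R -> (forall t, 0 <= a t) ->
  \esum_(t in S) (c%:E * a t) = c%:E * \esum_(t in S) a t.
Proof.
move=> c0 a0; rewrite /esum -ereal_supZl//; last first.
  by apply/set0P; exists 0, set0; [exact: fsets_set0|rewrite fsbig_set0].
congr ereal_sup; rewrite image_comp; apply: eq_imagel => X [finX _] /=.
by rewrite ge0_mule_fsumr.
Qed.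

Lemma esum_finType (J : finType) (V : pred J) (a : J -> \bar R) :
  (forall j, 0 <= a j) -> \esum_(j in [set j | V j]) a j = \sum_(j | V j) a j.
Proof.
move=> a0; rewrite esum_fset//; last exact: finite_finset.
rewrite -(@bigfs _ _ _ _ (index_enum J) V)// ?index_enum_uniq// => j _.
by rewrite mem_index_enum.
Qed.

Lemma esum_partition (T T' : choiceType) (J : finType) (V : pred J) (S : set T)
    (S' : set T') (e : J * T -> T') (a : T' -> \bar R) :
  set_bij ([set j | V j] `*` S) S' e -> (forall t, 0 <= a t) ->
  \esum_(t in S') a t = \sum_(j | V j) \esum_(t in S) a (e (j, t)).
Proof.
move=> bij_e a0; rewrite (reindex_esum _ _ _ _ bij_e).
rewrite (_ : _ `*` _ = [set j | V j] `*`` (fun=> S)); last by apply/seteqP; split => -[].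
rewrite -esum_finType => [|j]; last exact: esum_ge0.
by rewrite (@esum_esum _ _ _ _ _ (fun j t => a (e (j, t))))//; apply: eq_esum => -[].
Qed.

End ExtendedSums.

Section RealSums.
Variables (R : realType) (T : choiceType).
Implicit Types (S : set T) (f g p q : T -> R).

Definition rsummable S f := summable S (EFin \o f).

Definition rsum S f : R :=
  fine (\esum_(t in S) (f^\+ t)%:E) - fine (\esum_(t in S) (f^\- t)%:E).

Lemma rsummable_le S f g :
  rsummable S g -> (forall t, S t -> `|f t| <= g t) -> rsummable S f.
Proof.
move=> sg fg; apply: le_lt_trans sg; apply: le_esum => t St /=.
by rewrite lee_fin (le_trans (fg _ St))// ler_norm.
Qed.

Lemma rsummableD S f g : rsummable S f -> rsummable S g -> rsummable S (f \+ g).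
Proof. exact: summableD. Qed.

Lemma rsummableZ S f (c : R) : rsummable S f -> rsummable S (c \*o f).
Proof.
move=> sf; rewrite /rsummable /summable.
rewrite (eq_esum (b := fun t => `|c|%:E * `|(EFin \o f) t|)%E); last first.
  by move=> t _ /=; rewrite normrM.
by rewrite ge0_esumZl// lte_mul_pinfty// lee_fin.
Qed.

Lemma rsummable_funrpos S f : rsummable S f -> rsummable S f^\+.
Proof. by move=> /summable_funepos; rewrite funerpos. Qed.

Lemma rsummable_funrneg S f : rsummable S f -> rsummable S f^\-.
Proof. by move=> /summable_funeneg; rewrite funerneg. Qed.

Lemma ge0_esum_fin_num S p : (forall t, 0 <= p t) -> rsummable S p ->
  \esum_(t in S) (p t)%:E \is a fin_num.
Proof.
move=> p0; rewrite /rsummable summableE.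
by rewrite (eq_esum (b := fun t => (p t)%:E))// => t _ /=; rewrite ger0_norm.
Qed.

Lemma ge0_fine_esumD S p q : (forall t, 0 <= p t) -> (forall t, 0 <= q t) ->
  rsummable S p -> rsummable S q ->
  fine (\esum_(t in S) ((p \+ q) t)%:E) =
  fine (\esum_(t in S) (p t)%:E) + fine (\esum_(t in S) (q t)%:E).
Proof.
move=> p0 q0 sp sq; rewrite -fineD ?ge0_esum_fin_num//.
by rewrite -esumD// => t _; rewrite lee_fin.
Qed.

Lemma ge0_fine_esumZ S p (c : R) : 0 <= c -> (forall t, 0 <= p t) -> rsummable S p ->
  fine (\esum_(t in S) (c * p t)%:E) = c * fine (\esum_(t in S) (p t)%:E).
Proof.
move=> c0 p0 sp; rewrite -[c in RHS]/(fine c%:E) -fineM ?ge0_esum_fin_num//.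
by rewrite -ge0_esumZl.
Qed.

Lemma ge0_rsumB S p q : (forall t, 0 <= p t) -> (forall t, 0 <= q t) ->
  rsummable S p -> rsummable S q ->
  rsum S (p \- q) = fine (\esum_(t in S) (p t)%:E) - fine (\esum_(t in S) (q t)%:E).
Proof.
move=> p0 q0 sp sq; have spq : rsummable S (p \- q) := summableB sp sq.
rewrite /rsum -!fineB ?ge0_esum_fin_num//.
- have := esumB sp sq (fun t _ => p0 t) (fun t _ => q0 t).
  by rewrite (funerpos (p \- q)) (funerneg (p \- q)) => ->.
- exact: rsummable_funrpos.
- exact: rsummable_funrneg.
Qed.

Lemma eq_rsum S f g : (forall t, S t -> f t = g t) -> rsum S f = rsum S g.
Proof.
by move=> fg; congr (fine _ - fine _); apply: eq_esum => t St;
  rewrite /funrpos /funrneg fg.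
Qed.

Lemma rsumD S f g : rsummable S f -> rsummable S g ->
  rsum S (f \+ g) = rsum S f + rsum S g.
Proof.
move=> sf sg.
have [sfp sfn] := (rsummable_funrpos sf, rsummable_funrneg sf).
have [sgp sgn] := (rsummable_funrpos sg, rsummable_funrneg sg).
have -> : f \+ g = (f^\+ \+ g^\+) \- (f^\- \+ g^\-).
  have posneg (h : T -> R) t : h t = h^\+ t - h^\- t by rewrite -[in LHS](funrposBneg h).
  by apply/funext => t /=; rewrite (posneg f) (posneg g) opprD addrACA.
rewrite ge0_rsumB ?rsummableD// => [|t|t]; try exact: addr_ge0.
rewrite (ge0_fine_esumD _ _ sfp sgp)// (ge0_fine_esumD _ _ sfn sgn)//.
by rewrite opprD addrACA.
Qed.

Lemma rsumZ S f (c : R) : rsummable S f -> rsum S (c \*o f) = c * rsum S f.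
Proof.
move=> sf; have [sfp sfn] := (rsummable_funrpos sf, rsummable_funrneg sf).
have [c0|/ltW c0] := leP 0 c; rewrite /rsum.
  rewrite ge0_funrposM// ge0_funrnegM// mulrBr.
  by rewrite (ge0_fine_esumZ c0 _ sfp)// (ge0_fine_esumZ c0 _ sfn).
have Nc0 : 0 <= - c by rewrite oppr_ge0.
rewrite le0_funrposM// le0_funrnegM//.
rewrite (ge0_fine_esumZ Nc0 _ sfp)// (ge0_fine_esumZ Nc0 _ sfn)//.
by rewrite -mulrBr mulNr -mulrN opprB.
Qed.

End RealSums.

Lemma rsummableM (R : realType) (T T' : choiceType) (S : set T) (S' : set T')
    (f : T -> R) (g : T' -> R) :
  rsummable S f -> rsummable S' g -> rsummable (S `*` S') (fun k => f k.1 * g k.2).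
Proof.
move=> sf sg; rewrite /rsummable /summable.
rewrite (_ : S `*` S' = S `*`` (fun=> S')); last by apply/seteqP; split.
rewrite (eq_esum (b := fun k => `|f k.1|%:E * `|g k.2|%:E)%E); last first.
  by move=> k _ /=; rewrite normrM EFinM.
rewrite -(@esum_esum _ _ _ _ _ (fun t t' => `|f t|%:E * `|g t'|%:E)%E); last first.
  by move=> t t' _ _; rewrite mule_ge0.
have /fineK sum_g : \esum_(t' in S') `|g t'|%:E \is a fin_num.
  by move: (sg); rewrite /rsummable summableE.
rewrite (eq_esum (fun _ _ => ge0_esumZl _ _ _))// -sum_g.
under eq_esum do rewrite muleC.
rewrite ge0_esumZl ?fine_ge0 ?esum_ge0//.
by rewrite lte_mul_pinfty// lee_fin fine_ge0// esum_ge0.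
Qed.

Section ComplexSums.
Variables (R : realType) (T : choiceType).
Implicit Types (S : set T) (f g : T -> R[i]).
Local Notation Re := (@complex.Re R).
Local Notation Im := (@complex.Im R).
Local Notation normc := (@Normc.normc R).

Lemma normr_Re_le (x : R[i]) : `|Re x| <= normc x.
Proof. by rewrite -lecR normc_ge_Re. Qed.

Lemma normr_Im_le (x : R[i]) : `|Im x| <= normc x.
Proof. by case: x => a b /=; rewrite -sqrtr_sqr ler_wsqrtr// lerDr sqr_ge0. Qed.

Definition csummable S f := rsummable S (fun t => normc (f t)).

Lemma csumE S f : csum S f = (rsum S (Re \o f) +i* rsum S (Im \o f))%C.
Proof. by []. Qed.

Lemma csummable_Re S f : csummable S f -> rsummable S (Re \o f).
Proof. by move=> sf; apply: (rsummable_le sf) => t _; exact: normr_Re_le. Qed.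

Lemma csummable_Im S f : csummable S f -> rsummable S (Im \o f).
Proof. by move=> sf; apply: (rsummable_le sf) => t _; exact: normr_Im_le. Qed.

Lemma eq_csum S f g : (forall t, S t -> f t = g t) -> csum S f = csum S g.
Proof.
by move=> fg; rewrite !csumE; congr Complex; apply: eq_rsum => t St; rewrite /= fg.
Qed.

Lemma eq_csummable S f g : (forall t, S t -> f t = g t) -> csummable S f -> csummable S g.
Proof. by move=> fg; apply: le_lt_trans; apply: le_esum => t St /=; rewrite fg. Qed.

Lemma csummableZ S f (c : R[i]) : csummable S f -> csummable S (c \*o f).
Proof.
move=> /(rsummableZ (normc c)); apply: le_lt_trans; apply: le_esum => t _ /=.
by rewrite Normc.normcM.
Qed.

Lemma csumZ S f (c : R[i]) : csummable S f -> csum S (c \*o f) = c * csum S f.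
Proof.
move=> sf; have [sRe sIm] := (csummable_Re sf, csummable_Im sf).
rewrite !csumE; case: c => x y.
have -> : Re \o ((x +i* y)%C \*o f) =
    (x \*o (Re \o f)) \+ (- y \*o (Im \o f)).
  by apply/funext => t /=; case: (f t) => u v /=; rewrite mulNr.
have -> : Im \o ((x +i* y)%C \*o f) =
    (x \*o (Im \o f)) \+ (y \*o (Re \o f)).
  by apply/funext => t /=; case: (f t) => u v /=.
by rewrite !rsumD ?rsumZ//; try exact: rsummableZ; rewrite mulNr.
Qed.

End ComplexSums.

Section Partition.
Variables (R : realType) (T T' : choiceType) (J : finType) (V : pred J).
Variables (S : set T) (S' : set T') (e : J * T -> T').
Hypothesis bij_e : set_bij ([set j | V j] `*` S) S' e.

Lemma rsum_partition (f : T' -> R) :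
  (forall j, V j -> rsummable S (fun t => f (e (j, t)))) ->
  rsum S' f = \sum_(j | V j) rsum S (fun t => f (e (j, t))).
Proof.
move=> sf; rewrite /rsum !(esum_partition bij_e); try by move=> t; rewrite lee_fin.
rewrite -!sum_fine ?sumrB// => j /sf sfj; apply: ge0_esum_fin_num => //.
- exact: (rsummable_funrneg sfj).
- exact: (rsummable_funrpos sfj).
Qed.

Lemma csum_partition (f : T' -> R[i]) :
  (forall j, V j -> csummable S (fun t => f (e (j, t)))) ->
  csum S' f = \sum_(j | V j) csum S (fun t => f (e (j, t))).
Proof.
move=> sf; rewrite csumE !rsum_partition//.
- by elim/big_rec3: _ => [//|j x y z Vj <-]; rewrite csumE.
- by move=> j /sf/csummable_Im.
- by move=> j /sf/csummable_Re.
Qed.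

End Partition.

(** * Absolute values *)

Section NonarchimedeanAbs.
Variables (R : realType) (K : fieldType) (abs : K -> R).
Implicit Types x y : K.

Definition nonarchimedean_abs : Prop :=
  [/\ forall x, abs x = 0 <-> x = 0, forall x, 0 <= abs x,
      {morph abs : x y / x * y} & forall x y, abs (x + y) <= Num.max (abs x) (abs y)].

Hypothesis abs_nonarch : nonarchimedean_abs.

Lemma abs_eq0 x : abs x = 0 <-> x = 0. Proof. by case: abs_nonarch. Qed.
Lemma abs_ge0 x : 0 <= abs x. Proof. by case: abs_nonarch. Qed.
Lemma absM : {morph abs : x y / x * y}. Proof. by case: abs_nonarch. Qed.
Lemma absD_le x y : abs (x + y) <= Num.max (abs x) (abs y).
Proof. by case: abs_nonarch. Qed.

Lemma abs0 : abs 0 = 0. Proof. exact/abs_eq0. Qed.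

Lemma abs_gt0 x : (0 < abs x) = (x != 0).
Proof. by rewrite lt_def abs_ge0 andbT; congr (~~ _); apply/eqP/eqP => /abs_eq0. Qed.

Lemma abs1 : abs 1 = 1.
Proof.
by apply: (@mulfI _ (abs 1)); rewrite -?absM ?mulr1// gt_eqF// abs_gt0 oner_eq0.
Qed.

Lemma absN x : abs (- x) = abs x.
Proof.
rewrite -mulN1r absM; suff -> : abs (-1) = 1 by rewrite mul1r.
apply/eqP; rewrite -(eqrXn2 (n := 2)) ?abs_ge0//.
by rewrite expr2 -absM mulrNN mulr1 abs1 expr1n.
Qed.

Lemma absB_le x y : abs (x - y) <= Num.max (abs x) (abs y).
Proof. by rewrite -(absN y) absD_le. Qed.

Lemma absf_div x y : abs (x / y) = abs x / abs y.
Proof.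
have [->|y0] := eqVneq y 0; first by rewrite invr0 mulr0 abs0 invr0 mulr0.
have ay0 : abs y != 0 by rewrite gt_eqF// abs_gt0.
by apply: (mulIf ay0); rewrite -absM !divfK.
Qed.

End NonarchimedeanAbs.

Section DegreeAbs.
Variables (F : finFieldType) (R : realType).
Local Notation q := (qF F R).
Implicit Types a c d : {poly F}.

Lemma qF_gt1 : 1 < q.
Proof. by rewrite /qF ltr1n card_finNzRing_gt1. Qed.

Lemma qF_gt0 : 0 < q. Proof. exact: lt_trans ltr01 qF_gt1. Qed.

Lemma absA_neq0 a : a != 0 -> absA R a = q ^+ (size a).-1.
Proof. by rewrite /absA => /negPf->. Qed.

Lemma absA_gt0 a : (0 < absA R a) = (a != 0).
Proof.
have [->|a0] := eqVneq a 0; first by rewrite /absA eqxx ltxx.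
by rewrite absA_neq0// exprn_gt0// qF_gt0.
Qed.

Lemma absA_unit a : a \is a GRing.unit -> absA R a = 1.
Proof.
move=> ua; have a0 : a != 0 by apply: contraTneq ua => ->; rewrite unitr0.
by move: ua; rewrite absA_neq0// poly_unitE => /andP[/eqP-> _].
Qed.

Lemma expr_size_le_max_absA a : q ^+ size a <= q * Num.max 1 (absA R a).
Proof.
have [->|a0] := eqVneq a 0.
  by rewrite size_poly0 expr0 mulr_ege1 ?le_max ?lexx// ltW// qF_gt1.
by rewrite absA_neq0// (polySpred a0) exprS ler_pM2l ?qF_gt0// le_max lexx orbT.
Qed.

Lemma max_absA_ge1 c d : (c != 0) || (d != 0) -> 1 <= Num.max (absA R c) (absA R d).
Proof.
have absA_ge1 a : a != 0 -> 1 <= absA R a.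
  by move=> a0; rewrite absA_neq0// exprn_ege1// ltW// qF_gt1.
by rewrite le_max => /orP[/absA_ge1->|/absA_ge1->]; rewrite ?orbT.
Qed.

End DegreeAbs.

Section PolynomialSums.
Variables (F : finFieldType) (R : realType).
Local Notation q := (qF F R).

Lemma esum_geometric_lty (x : R) : 0 < x -> x < 1 ->
  (\esum_(k in [set: nat]) (x ^+ k)%:E < +oo)%E.
Proof.
move=> x0 x1; rewrite -nneseries_esumT => [|k]; last by rewrite lee_fin exprn_ge0// ltW.
apply: (@le_lt_trans _ _ (1 / (1 - x))%:E); last exact: ltry.
apply: lime_le.
  by apply: is_cvg_nneseries => k _ _; rewrite lee_fin exprn_ge0// ltW.
apply: nearW => k; rewrite sumEFin lee_fin.
apply: le_trans (geometric_le_lim k ler01 x0 _); last by rewrite gtr0_norm.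
by rewrite /series /= ler_sum// => i _; rewrite /geometric /= mul1r.
Qed.

Lemma esum_size_eq_le (k : nat) (x : R) : 0 <= x ->
  (\esum_(c in [set c : {poly F} | size c = k]) x%:E <= (q ^+ k * x)%:E)%E.
Proof.
move=> x0.
have coefv_inj : set_inj [set c : {poly F} | size c = k] (@coefv F k).
  move=> c d /set_mem /= sc /set_mem /= sd eq_cd.
  by rewrite -(coefvK (m := k) (p := c)) ?sc// eq_cd coefvK// sd.
rewrite -(esum_image _ _ (fun=> x%:E) coefv_inj).
apply: (le_trans (le_esum_set _ (@subsetT _ _))).
rewrite (_ : setT = [set v | predT v]); last by apply/seteqP.
rewrite esum_finType => [|v]; last by rewrite lee_fin.
by rewrite sumEFin sumr_const card_ffun card_ord -mulr_natl natrX.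
Qed.

Lemma rsummable_expr_size (r : R) : 0 < r -> q * r < 1 ->
  rsummable [set: {poly F}] (fun c => r ^+ size c).
Proof.
move=> r0 qr1; have rX_ge0 k : 0 <= r ^+ k by rewrite exprn_ge0// ltW.
rewrite /rsummable /summable.
rewrite (_ : setT = \bigcup_(k in setT) [set c : {poly F} | size c = k]).
  rewrite esum_bigcupT//; last by move=> i j _ _ [c [/= <- <-]].
  apply: le_lt_trans (esum_geometric_lty (mulr_gt0 (qF_gt0 F R) r0) qr1).
  apply: le_esum => k _; rewrite exprMn.
  apply: le_trans (esum_size_eq_le _ (rX_ge0 k)).
  by apply: le_esum => c /= ->; rewrite ger0_norm.
by apply/seteqP; split => // c _; exists (size c).
Qed.

Lemma qF_powRN_lt1 (t : R) : 1 < t -> q * q `^ (- t) < 1.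
Proof.
move=> t1; have ln_q0 : 0 < ln q by rewrite ln_gt0// qF_gt1.
rewrite powRN ltr_pdivrMr ?powR_gt0 ?qF_gt0// mul1r.
rewrite /powR gt_eqF ?qF_gt0// -{1}(lnK (x := q)) ?posrE ?qF_gt0// ltr_expR.
by rewrite -{1}(mul1r (ln q)) ltr_pM2r.
Qed.

Lemma powR_exprV (x t : R) (k : nat) : 0 <= x -> (x ^- k) `^ t = (x `^ (- t)) ^+ k.
Proof.
move=> x0; rewrite -powR_invn// -(powR_mulrn k (powR_ge0 x _)) -!powRrM.
by congr (_ `^ _); rewrite mulrC mulrN mulNr.
Qed.

Lemma rsummable_coset_row1 (w : {poly F} * {poly F} -> R) : rsummable setT w ->
  rsummable (@cosets F) (fun C => w (coset_repr C i1 i0, coset_repr C i1 i1)).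
Proof.
pose row1 (C : set 'M[{poly F}]_2) := (coset_repr C i1 i0, coset_repr C i1 i1).
have row1_inj : set_inj (@cosets F) row1.
  move=> C D /set_mem cC /set_mem cD [eq10 eq11].
  rewrite -(coset_reprK cC) -(coset_reprK cD).
  by apply: eq_rcoset_row1 => //; apply: GL2A_coset_repr.
apply: le_lt_trans; rewrite -(esum_image _ _ (fun k => `|(w k)%:E|%E) row1_inj).
exact: le_esum_set.
Qed.

End PolynomialSums.

Section ComplexPowers.
Variable R : realType.
Implicit Types (x y : R) (s t : R[i]).

Lemma normc_cpow x s : 0 < x -> Normc.normc (cpow x s) = x `^ complex.Re s.
Proof.
move=> x0; rewrite /cpow Normc.normcM /= cos2Dsin2 sqrtr1 mulr1 expr0n addr0.
by rewrite sqrtr_sqr ger0_norm ?expR_ge0// /powR gt_eqF.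
Qed.

Lemma cpowM x y s : 0 < x -> 0 < y -> cpow (x * y) s = cpow x s * cpow y s.
Proof.
move=> x0 y0; rewrite /cpow lnM ?posrE// !mulrDr expRD cosD sinD.
by apply/eqP; rewrite eq_complex /=; apply/andP; split; apply/eqP; ring.
Qed.

Lemma cpowD x s t : cpow x (s + t) = cpow x s * cpow x t.
Proof.
case: s t => [s s'] [t t']; rewrite /cpow /= !mulrDl expRD cosD sinD.
by apply/eqP; rewrite eq_complex /=; apply/andP; split; apply/eqP; ring.
Qed.

Lemma cpowr1 x : 0 < x -> cpow x 1 = (x%:C)%C.
Proof.
move=> x0; rewrite /cpow /= mul1r mul0r lnK ?posrE// cos0 sin0.
by apply/eqP; rewrite eq_complex /= !(mulr0, mul0r, mulr1, subr0, addr0) !eqxx.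
Qed.

(* Multiplying by y^(2s) and then by y^(1-2s) avoids any division. *)
Lemma cpow_div_sqr x y s : 0 < x -> 0 < y ->
  cpow (x / y ^+ 2) s * (y%:C)%C = cpow x s * cpow y (1 - 2%:R * s).
Proof.
move=> x0 y0; have y2 : 0 < y ^+ 2 by rewrite exprn_gt0.
have -> : (y%:C)%C = cpow y (s + s) * cpow y (1 - 2%:R * s).
  by rewrite -cpowD -cpowr1//; congr cpow; ring.
have {2}-> : x = x / y ^+ 2 * (y * y) by rewrite -expr2 mulfVK// gt_eqF.
by rewrite !cpowM ?mulr_gt0 ?invr_gt0// cpowD mulrA.
Qed.

End ComplexPowers.

(** * The action of matrices on the upper half plane *)

Section Eisenstein.
Variables (F : finFieldType) (R : realType) (K : closedFieldType).
Variables (abs : K -> R) (emb : {rmorphism {poly F} -> K}).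
Hypothesis abs_nonarch : nonarchimedean_abs abs.
Hypothesis abs_emb : forall a, abs (emb a) = absA R a.
Implicit Types (x y z w : K) (a b c d n : {poly F}) (g h : 'M[{poly F}]_2).
Implicit Types (s : R[i]) (C : set 'M[{poly F}]_2).

Local Notation imag := (imag_abs abs emb).
Local Notation q := (qF F R).

Let abs0 := abs0 abs_nonarch.
Let abs_ge0 := abs_ge0 abs_nonarch.
Let absM := absM abs_nonarch.
Let abs_gt0 := abs_gt0 abs_nonarch.

Lemma emb_eq0 a : (emb a == 0) = (a == 0).
Proof. by apply: negb_inj; rewrite -abs_gt0 abs_emb absA_gt0. Qed.

Lemma kinf_frac a b : b != 0 -> kinf abs emb (emb a / emb b).
Proof. by move=> b0 e e0; exists a, b; rewrite subrr abs0. Qed.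

Lemma imag_le z w : kinf abs emb w -> imag z <= abs (z - w).
Proof.
move=> kw; apply: ge_inf; last by exists w.
by exists 0 => _ [v _ <-]; exact: abs_ge0.
Qed.

(* F_q(T) is dense in k_infty, so it suffices to bound distances to fractions. *)
Lemma imag_ge z (t : R) : 0 < t ->
  (forall a b, b != 0 -> t <= abs (z - emb a / emb b)) -> t <= imag z.
Proof.
move=> t0 frac_ge; apply: lb_le_inf.
  exists (abs (z - emb 0 / emb 1)); exists (emb 0 / emb 1) => //.
  by apply: kinf_frac; rewrite oner_neq0.
move=> _ [w kw <-]; rewrite leNgt; apply/negP => zw.
have [a [b [b0 wab]]] := kw _ t0.
have := frac_ge a b b0; rewrite leNgt => /negP; apply.
have -> : z - emb a / emb b = (z - w) + (w - emb a / emb b) by ring.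
by rewrite (le_lt_trans (absD_le abs_nonarch _ _))// gt_max zw.
Qed.

Lemma OmegaP z : Omega abs emb z <-> 0 < imag z.
Proof.
split=> [Oz|z0 kz]; last first.
  by have := imag_le z kz; rewrite subrr abs0 leNgt z0.
have [e /not_implyP[e0 far]] := (existsNP _).2 Oz.
apply: (lt_le_trans e0); apply: imag_ge => // a b b0.
by rewrite leNgt; apply/negP => zab; apply: far; exists a, b.
Qed.

Lemma imag_linear_le z c d : abs (emb c) * imag z <= abs (emb c * z + emb d).
Proof.
have [->|c0] := eqVneq c 0; first by rewrite rmorph0 abs0 mul0r abs_ge0.
have ec : emb c != 0 by rewrite emb_eq0.
have -> : emb c * z + emb d = emb c * (z - emb (- d) / emb c).
  by rewrite rmorphN; field.
by rewrite absM ler_wpM2l ?abs_ge0// imag_le//; apply: kinf_frac.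
Qed.

Definition rowform g (i : 'I_2) z : K := emb (g i i0) * z + emb (g i i1).
Local Notation autfac g := (rowform g i1).

Lemma mobE g z : mob emb g z = rowform g i0 z / autfac g z. Proof. by []. Qed.

Lemma rowform_scalar a z : rowform a%:M i0 z = emb a * z /\ autfac a%:M z = emb a.
Proof. by rewrite /rowform scalar_mx2 !mx2E rmorph0 addr0 mul0r add0r. Qed.

Lemma rowform_mul g h i z : autfac h z != 0 ->
  rowform (g *m h) i z = rowform g i (mob emb h z) * autfac h z.
Proof.
move=> hz0; rewrite [in RHS]/rowform mobE mulrDl -mulrA divfK//.
by rewrite /rowform !mulmx22E !rmorphD !rmorphM; ring.
Qed.

Lemma mob_mul g h z : autfac h z != 0 -> mob emb (g *m h) z = mob emb g (mob emb h z).
Proof. by move=> hz0; rewrite [LHS]mobE !rowform_mul// -mulf_div divff// mulr1. Qed.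

Lemma mob_scalar a z : a != 0 -> mob emb a%:M z = z.
Proof.
move=> a0; have [num den] := rowform_scalar a z.
by rewrite mobE num den mulrAC mulfV ?mul1r// emb_eq0.
Qed.

Lemma autfac_neq0 g z : Omega abs emb z -> \det g != 0 -> autfac g z != 0.
Proof.
move=> /OmegaP z0 /row1_neq0; rewrite /rowform.
have [->|g10 _] := eqVneq (g i1 i0) 0; first by rewrite rmorph0 mul0r add0r /= emb_eq0.
rewrite -abs_gt0 (lt_le_trans _ (imag_linear_le _ _ _))// mulr_gt0//.
by rewrite abs_gt0 emb_eq0.
Qed.

(* With X = az + b and Y = cz + d one has aY - cX = ad - bc, while
   |a| |z|_i <= |X| and |c| |z|_i <= |Y|; conclude by the ultrametric inequality. *)
Lemma imag_det_le g z :
  abs (emb (\det g)) * imag z <= abs (rowform g i0 z) * abs (autfac g z).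
Proof.
have [z0|z0] := leP (imag z) 0.
  by rewrite (le_trans (mulr_ge0_le0 _ z0)) ?abs_ge0// mulr_ge0 ?abs_ge0.
have -> : emb (\det g) = emb (g i0 i0) * autfac g z - emb (g i1 i0) * rowform g i0 z.
  by rewrite det_mx22E rmorphB !rmorphM /rowform; ring.
apply: le_trans (ler_wpM2r (ltW z0) (absB_le abs_nonarch _ _)) _.
rewrite maxr_pMl ?(ltW z0)// ge_max !absM; apply/andP; split.
  by rewrite mulrAC ler_wpM2r ?abs_ge0// imag_linear_le.
by rewrite mulrAC mulrC ler_wpM2l ?abs_ge0// imag_linear_le.
Qed.

Lemma imag_mob_ge g z : Omega abs emb z -> \det g != 0 ->
  abs (emb (\det g)) * imag z / abs (autfac g z) ^+ 2 <= imag (mob emb g z).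
Proof.
move=> Oz dg; have gz0 := autfac_neq0 Oz dg; have z0 := (OmegaP z).1 Oz.
have agz0 : 0 < abs (autfac g z) by rewrite abs_gt0.
apply: imag_ge => [|a b b0].
  by rewrite divr_gt0 ?exprn_gt0// mulr_gt0// abs_gt0 emb_eq0.
have eb : emb b != 0 by rewrite emb_eq0.
have := imag_det_le (mx2 b (- a) 0 1 *m g) z.
rewrite !rowform_mul// det_mulmx det_mx2 mulr1 mulr0 subr0 rmorphM !absM /rowform !mx2E.
rewrite -/(autfac g z) rmorph0 rmorph1 mul0r add0r rmorphN (abs1 abs_nonarch) mul1r.
have -> : emb b * mob emb g z - emb a = emb b * (mob emb g z - emb a / emb b) by field.
rewrite absM -!mulrA ler_pM2l ?abs_gt0// !mulrA => le_dist.
by rewrite ler_pdivrMr ?exprn_gt0// expr2 mulrA.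
Qed.

Lemma mob_Omega g z : Omega abs emb z -> \det g != 0 -> Omega abs emb (mob emb g z).
Proof.
move=> Oz dg; apply/OmegaP; apply: lt_le_trans (imag_mob_ge Oz dg).
rewrite divr_gt0 ?exprn_gt0 ?abs_gt0 ?autfac_neq0//.
by rewrite mulr_gt0 ?abs_gt0 ?emb_eq0//; apply/OmegaP.
Qed.

(* The converse inequality is the previous one for the adjugate of g, which
   acts as the inverse of g. *)
Lemma imag_mob g z : Omega abs emb z -> \det g != 0 ->
  imag (mob emb g z) = abs (emb (\det g)) * imag z / abs (autfac g z) ^+ 2.
Proof.
move=> Oz dg; apply/eqP; rewrite eq_le imag_mob_ge// andbT.
have gz0 := autfac_neq0 Oz dg.
have adjK : mob emb (\adj g) (mob emb g z) = z.
  by rewrite -mob_mul// mul_adj_mx mob_scalar.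
have adj_autfac : autfac (\adj g) (mob emb g z) = emb (\det g) / autfac g z.
  apply: (canRL (mulfK gz0)); rewrite -rowform_mul// mul_adj_mx.
  by have [] := rowform_scalar (\det g) z.
have := @imag_mob_ge (\adj g) _ (mob_Omega Oz dg).
rewrite det_adj// expr1 adjK adj_autfac (absf_div abs_nonarch) => /(_ dg).
have det_gt0 : 0 < abs (emb (\det g)) by rewrite abs_gt0 emb_eq0.
have autfac_gt0 : 0 < abs (autfac g z) by rewrite abs_gt0.
move: det_gt0 autfac_gt0; set D := abs _; set j := abs _ => D0 j0.
rewrite ler_pdivrMr ?exprn_gt0 ?divr_gt0// ler_pdivlMr ?exprn_gt0// => le_adj.
have -> : D * imag z = imag z * (D / j) ^+ 2 * j ^+ 2 / D by field; rewrite !gt_eqF.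
by rewrite ler_pdivlMr// mulrAC ler_pM2r ?exprn_gt0// mulrC.
Qed.

Lemma imag_mob_GL2A g z : Omega abs emb z -> GL2A g ->
  imag (mob emb g z) = imag z / abs (autfac g z) ^+ 2.
Proof. by move=> Oz Gg; rewrite imag_mob ?GL2A_det_neq0// abs_emb absA_unit// mul1r. Qed.

Lemma imag_mob_Binf g z : Omega abs emb z -> Binf g -> imag (mob emb g z) = imag z.
Proof.
move=> Oz [Gg g10]; rewrite imag_mob_GL2A// /rowform g10 rmorph0 mul0r add0r abs_emb.
move: Gg; rewrite /GL2A /= det_mx22E g10 mulr0 subr0 unitrM => /andP[_ /absA_unit ->].
by rewrite expr1n divr1.
Qed.

Lemma imag_mob_repr g z : Omega abs emb z -> \det g != 0 ->
  imag (mob emb (coset_repr (rcoset g)) z) = imag (mob emb g z).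
Proof.
move=> Oz dg; have [u Bu ->] := coset_repr_rcoset g.
by rewrite mob_mul ?autfac_neq0// imag_mob_Binf//; apply: mob_Omega.
Qed.

Lemma mob_hermite n (j : hermite_index n) z :
  mob emb (hermite_mx j) z =
  (emb (polyv (tag j)) * z + emb (polyv (tagged j))) / emb (n %/ polyv (tag j)).
Proof. by rewrite /mob !mx2E rmorph0 mul0r add0r. Qed.

Lemma imag_mob_hermite n (j : hermite_index n) z : n != 0 -> hermite_valid j ->
  Omega abs emb z ->
  imag (mob emb (hermite_mx j) z) =
  absA R n / absA R (n %/ polyv (tag j)) ^+ 2 * imag z.
Proof.
move=> n0 vj Oz; have detE := det_hermite_mx vj.
by rewrite imag_mob ?detE// /rowform !mx2E rmorph0 mul0r add0r !abs_emb mulrAC.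
Qed.

(** * Convergence of the Eisenstein series *)

Lemma max_absA_le_linear z : Omega abs emb z -> exists2 L : R, 0 < L &
  forall c d, Num.max (absA R c) (absA R d) <= L * abs (emb c * z + emb d).
Proof.
move=> /OmegaP z0; have az := abs_ge0 z.
have quot_ge0 : 0 <= abs z / imag z by rewrite divr_ge0// ltW.
have inv_ge0 : 0 <= (imag z)^-1 by rewrite invr_ge0 ltW.
exists (1 + abs z / imag z + (imag z)^-1); first by rewrite -addrA ltr_pwDl// addr_ge0.
move=> c d; set L := _ + _; set j := abs (_ + _).
have j0 : 0 <= j := abs_ge0 _.
have cj : absA R c <= (imag z)^-1 * j.
  by rewrite mulrC ler_pdivlMr// -abs_emb; apply: imag_linear_le _ _ _.
have dj : absA R d <= Num.max j (absA R c * abs z).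
  rewrite -!abs_emb -absM -{1}(addKr (emb c * z) (emb d)) addrC.
  exact: absB_le.
have cL : absA R c <= L * j by rewrite (le_trans cj)// ler_wpM2r// lerDr addr_ge0.
rewrite ge_max cL (le_trans dj)// ge_max; apply/andP; split.
  by rewrite -[leLHS]mul1r ler_wpM2r// /L -addrA lerDl addr_ge0.
apply: (@le_trans _ _ (abs z / imag z * j)).
  by rewrite mulrC -mulrA ler_wpM2l.
by rewrite ler_wpM2r// /L addrAC lerDr addr_ge0.
Qed.

Lemma imag_mob_GL2A_le z : Omega abs emb z -> exists2 M : R, 0 < M &
  forall g, GL2A g ->
    imag (mob emb g z) <= M * (q ^- size (g i1 i0) * q ^- size (g i1 i1)).
Proof.
move=> Oz; have z0 := (OmegaP z).1 Oz; have q0 := qF_gt0 F R.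
have [L L0 max_le] := max_absA_le_linear Oz.
exists (imag z * (q * L) ^+ 2) => [|g Gg].
  by rewrite mulr_gt0// exprn_gt0// mulr_gt0.
have dg := GL2A_det_neq0 Gg.
rewrite imag_mob_GL2A// -mulrA ler_pM2l// -invfM.
have j0 : 0 < abs (autfac g z) by rewrite abs_gt0 autfac_neq0.
have size_le c : absA R c <= Num.max (absA R (g i1 i0)) (absA R (g i1 i1)) ->
    q ^+ size c <= q * L * abs (autfac g z).
  move=> c_le; rewrite (le_trans (expr_size_le_max_absA R c))// -mulrA ler_pM2l//.
  by rewrite (le_trans _ (max_le _ _))// ge_max max_absA_ge1 ?row1_neq0.
rewrite ler_pdivlMr ?mulr_gt0 ?exprn_gt0// mulrC ler_pdivrMr ?exprn_gt0// -exprMn expr2.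
by rewrite ler_pM ?exprn_ge0 ?(ltW q0)// size_le// le_max lexx ?orbT.
Qed.

Definition eis_term z s C : R[i] := cpow (imag (mob emb (coset_repr C) z)) s.

Lemma EisE z s : Eis abs emb z s = csum (@cosets F) (eis_term z s). Proof. by []. Qed.

Lemma csummable_eis_term z s : Omega abs emb z -> 1 < complex.Re s ->
  csummable (@cosets F) (eis_term z s).
Proof.
move=> Oz s1; set t := complex.Re s in s1 *.
have t0 : 0 <= t by rewrite ltW// (lt_trans ltr01).
have [M M0 imag_le] := imag_mob_GL2A_le Oz; have q0 := qF_gt0 F R.
pose r := q `^ (- t); pose w (k : {poly F} * {poly F}) := r ^+ size k.1 * r ^+ size k.2.
have sr := rsummable_expr_size (powR_gt0 (- t) q0) (qF_powRN_lt1 F s1).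
have sw : rsummable setT w by rewrite -setXTT; exact: (rsummableM sr sr).
apply: (rsummable_le (rsummableZ (M `^ t) (rsummable_coset_row1 sw))) => C cC.
have imag0 : 0 < imag (mob emb (coset_repr C) z).
  by apply/OmegaP; apply: mob_Omega; rewrite ?det_coset_repr_neq0.
rewrite normc_cpow// ger0_norm ?powR_ge0//=.
apply: le_trans (ge0_ler_powR t0 _ _ (imag_le _ (GL2A_coset_repr cC))) _.
- by rewrite nnegrE ltW.
- by rewrite nnegrE !mulr_ge0 ?invr_ge0 ?exprn_ge0// ltW.
rewrite !powRM ?mulr_ge0 ?invr_ge0 ?exprn_ge0 ?(ltW M0) ?(ltW q0)//.
by rewrite !powR_exprV ?(ltW q0).
Qed.

(** * The Hecke operator *)

Lemma eis_term_repr_mul_hermite n z s (j : hermite_index n) C :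
  n != 0 -> Omega abs emb z -> hermite_valid j -> cosets C ->
  eis_term z s (rcoset (coset_repr C *m hermite_mx j)) =
  eis_term (mob emb (hermite_mx j) z) s C.
Proof.
move=> n0 Oz vj cC; have dj : \det (hermite_mx j) != 0 by rewrite det_hermite_mx.
rewrite /eis_term imag_mob_repr//; first by rewrite mob_mul// autfac_neq0.
by rewrite det_mulmx mulf_neq0// det_coset_repr_neq0.
Qed.

Lemma eis_term_hermite_mul_repr n z s (j : hermite_index n) C :
  n != 0 -> Omega abs emb z -> hermite_valid j -> cosets C ->
  eis_term z s (rcoset (hermite_mx j *m coset_repr C)) =
  cpow (absA R n / absA R (n %/ polyv (tag j)) ^+ 2) s * eis_term z s C.
Proof.
move=> n0 Oz vj cC; have dj : \det (hermite_mx j) != 0 by rewrite det_hermite_mx.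
have dC := det_coset_repr_neq0 cC; have OCz := mob_Omega Oz dC.
rewrite /eis_term imag_mob_repr ?det_mulmx ?mulf_neq0//.
rewrite mob_mul ?autfac_neq0// imag_mob_hermite// cpowM//; last exact/OmegaP.
by rewrite divr_gt0 ?exprn_gt0// absA_gt0// divp_divisor_neq0.
Qed.

Section HeckeEigenvalue.
Variables (n : {poly F}) (z : K) (s : R[i]).
Hypotheses (n_monic : n \is monic) (Oz : Omega abs emb z) (s_gt1 : 1 < complex.Re s).

Let n0 : n != 0 := monic_neq0 n_monic.

Lemma hecke_EisE :
  hecke emb (fun w => Eis abs emb w s) n z = csum (det_cosets n) (eis_term z s).
Proof.
rewrite (csum_partition (set_bij_repr_mul_hermite n_monic)); last first.
  move=> j vj; have Ojz : Omega abs emb (mob emb (hermite_mx j) z).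
    by apply: mob_Omega; rewrite ?det_hermite_mx.
  apply: eq_csummable (csummable_eis_term Ojz s_gt1) => C cC.
  by rewrite eis_term_repr_mul_hermite.
rewrite /hecke sig_big_dep; apply: eq_big => [j|j /andP[vj _]]; first by rewrite andbT.
rewrite -mob_hermite EisE; apply: eq_csum => C cC.
by rewrite eis_term_repr_mul_hermite.
Qed.

Lemma csum_det_cosets_hermite :
  csum (det_cosets n) (eis_term z s) =
  (\sum_(j : hermite_index n | hermite_valid j)
     cpow (absA R n / absA R (n %/ polyv (tag j)) ^+ 2) s) * Eis abs emb z s.
Proof.
have sE := csummable_eis_term Oz s_gt1.
rewrite (csum_partition (set_bij_hermite_mul_repr n_monic)) => [|j vj]; last first.
  pose scale := cpow (absA R n / absA R (n %/ polyv (tag j)) ^+ 2) s.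
  apply: eq_csummable (csummableZ scale sE) => C cC.
  by rewrite eis_term_hermite_mul_repr.
rewrite mulr_suml; apply: eq_bigr => j vj; rewrite EisE -csumZ//.
by apply: eq_csum => C cC; rewrite eis_term_hermite_mul_repr.
Qed.

End HeckeEigenvalue.

End Eisenstein.

Lemma sum_hermite_sigmaA (F : finFieldType) (R : realType) (n : {poly F}) (s : R[i]) :
  n \is monic ->
  \sum_(j : hermite_index n | hermite_valid j)
    cpow (absA R n / absA R (n %/ polyv (tag j)) ^+ 2) s =
  cpow (absA R n) s * sigmaA (1 - 2%:R * s) n.
Proof.
move=> nm; have n0 := monic_neq0 nm.
transitivity (\sum_(t : {ffun 'I_(size n) -> F} | monic_divisor t)
    \sum_(v : {ffun 'I_(size (n %/ polyv t)).-1 -> F})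
      cpow (absA R n / absA R (n %/ polyv t) ^+ 2) s).
  by rewrite sig_big_dep; apply: eq_bigl => j; rewrite andbT.
rewrite /sigmaA mulr_sumr.
rewrite -(sum_divisor_compl
  (fun d => cpow (absA R n) s * cpow (absA R d) (1 - 2 * s)) nm).
apply: eq_bigr => t dt; have d0 := divp_divisor_neq0 n0 dt.
rewrite -cpow_div_sqr ?absA_gt0// sumr_const card_ffun card_ord -mulr_natr; congr (_ * _).
by rewrite absA_neq0// /qF -natrX rmorph_nat.
Qed.

Lemma is_Cinf_nonarchimedean (F : finFieldType) (R : realType) (K : closedFieldType)
    (abs : K -> R) (emb : {rmorphism {poly F} -> K}) :
  is_Cinf abs emb -> nonarchimedean_abs abs /\ forall a, abs (emb a) = absA R a.
Proof. by move=> [abs_eq0 [abs_ge0 [absM [absD_le [abs_emb _]]]]]. Qed.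

Theorem theorem6p5 (F : finFieldType) (R : realType) (K : closedFieldType)
  (abs : K -> R) (emb : {rmorphism {poly F} -> K}) :
  odd #|F| -> is_Cinf abs emb ->
  forall n : {poly F}, n \is monic ->
  forall z : K, Omega abs emb z ->
  forall s : R[i], 1 < complex.Re s ->
  hecke emb (fun w => Eis abs emb w s) n z =
    cpow (absA R n) s * sigmaA (1 - 2%:R * s) n * Eis abs emb z s.
Proof.
move=> _ /is_Cinf_nonarchimedean[abs_nonarch abs_emb] n n_monic z Oz s s_gt1.
rewrite (hecke_EisE abs_nonarch abs_emb n_monic Oz s_gt1).
rewrite (csum_det_cosets_hermite abs_nonarch abs_emb n_monic Oz s_gt1).
by rewrite sum_hermite_sigmaA.
Qed.
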